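(* Let $b,g\in\mathbb R$, $b\neq0$, $\nu,a_1,a_2\in\mathbb C$, and consider the linear system on $Y=(Y_1(z),Y_2(z))$ $$Y'=\left(\frac1z\begin{pmatrix}\nu&0\\0&0\end{pmatrix}+\frac1{(z-1)^2}\begin{pmatrix}a_2&b\\-b&a_2-g\end{pmatrix}+\frac1{z-1}\begin{pmatrix}a_1&0\\0&a_1+\nu-\bar\nu\end{pmatrix}\right)Y.$$ 1) The system is equivalent to a confluent Heun equation of the form $$z(z-1)^2E''+(pz(z-1)+qz+s)E'+(uz+d)E=0\qquad (p,q,s,u,d\in\mathbb C)$$ on the second component $E=Y_2(z)$ of its solutions (i.e., there is an equation of this form satisfied by $E=Y_2(z)$ for every solution $Y=(Y_1,Y_2)$ of the system) if and only if the parameters satisfy the system of two equations $$b^2=a_2(g-a_2),\qquad a_2(\nu-\bar\nu)+a_1(2a_2-g)=0.$$ 2) In this case the corresponding coefficients of the confluent Heun equation are $$p=\bar\nu+2-2\nu-2a_1,\quad q=\nu+g-2a_2,\quad s=-\nu,$$ $$u=(a_1+\nu-1)(a_1+\nu-\bar\nu),\quad d=\nu(a_2-g-a_1-\nu+\bar\nu).$$ *)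

(* Defs.v *)
From Stdlib Require Export Reals.
From Coquelicot Require Export Coquelicot.

Open Scope C_scope.

(* Solutions of a linear system with poles at 0 and 1 are multivalued on
   C \ {0,1}; they are represented by their single-valued holomorphic
   determinations, each living on some open subset of C \ {0,1}. *)
Definition regular_domain (U : C -> Prop) : Prop :=
  open U /\ ~ U 0 /\ ~ U 1.

(* [is_derive] is used over [C_AbsRing], i.e. it is complex
   differentiability.  The two conjuncts are the rows of the matrix system
     Y' = ( 1/z       * [ nu, 0 ;  0, 0                  ]
          + 1/(z-1)^2 * [ a2, b ; -b, a2 - g             ]
          + 1/(z-1)   * [ a1, 0 ;  0, a1 + nu - conj nu  ] ) Y. *)
Definition solves_system (b g : R) (nu a1 a2 : C)
    (U : C -> Prop) (Y1 Y2 : C -> C) : Prop :=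
  forall z : C, U z ->
    is_derive (K := C_AbsRing) (V := C_NormedModule) Y1 z
      (1 / z * (nu * Y1 z + 0 * Y2 z)
       + 1 / (z - 1) ^ 2 * (a2 * Y1 z + b * Y2 z)
       + 1 / (z - 1) * (a1 * Y1 z + 0 * Y2 z)) /\
    is_derive (K := C_AbsRing) (V := C_NormedModule) Y2 z
      (1 / z * (0 * Y1 z + 0 * Y2 z)
       + 1 / (z - 1) ^ 2 * (- b * Y1 z + (a2 - g) * Y2 z)
       + 1 / (z - 1) * (0 * Y1 z + (a1 + nu - Cconj nu) * Y2 z)).

(* [C_derive] is total, so twice complex differentiability is required
   explicitly. *)
Definition solves_confluent_Heun (p q s u d : C)
    (U : C -> Prop) (E : C -> C) : Prop :=
  forall z : C, U z ->
    ex_derive (K := C_AbsRing) (V := C_NormedModule) E z /\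
    ex_derive (K := C_AbsRing) (V := C_NormedModule) (C_derive E) z /\
    z * (z - 1) ^ 2 * C_derive (C_derive E) z
      + (p * (z * (z - 1)) + q * z + s) * C_derive E z
      + (u * z + d) * E z = 0.

Definition second_component_satisfies_Heun (b g : R) (nu a1 a2 : C)
    (p q s u d : C) : Prop :=
  forall (U : C -> Prop) (Y1 Y2 : C -> C),
    regular_domain U ->
    solves_system b g nu a1 a2 U Y1 Y2 ->
    solves_confluent_Heun p q s u d U Y2.

(* Main.v *)
Require Import Defs.
From Stdlib Require Import Lra FunctionalExtensionality.

(** Eliminating [Y1] between the two rows gives, for every solution of the
    system, an identity
      z (z-1)^2 Y2'' + (p z (z-1) + q z + s) Y2' + (u z + d) Y2
        = D1(z) Y2' + D0(z) Y2
    with rational functions [D1] and [D0] that depend only on the parameters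
    ([Heun_defect]).  They are the coefficients of the candidate equation
    minus those of the second-order equation that [Y2] does satisfy, normalized
    to the same leading coefficient: [D1] is a polynomial of degree at most two,
    and [D0] is a polynomial of degree at most one plus multiples of
    z / (z-1)^2 and z / (z-1).

    If [D1] and [D0] vanish identically, the Heun equation holds.  Conversely,
    near every regular point z0 the system has a holomorphic solution with
    prescribed value at z0 ([system_local_solution]).  As b is nonzero, the
    value of [Y1] can be chosen so that (Y2, Y2') takes the values (0, 1) at
    z0, and Y2(z0) = 1 with D1(z0) = 0 then isolates D0(z0); so both defects
    vanish at every z0 other than 0 and 1 ([Heun_iff_defects_vanish]).
    Comparing coefficients, the vanishing of [D1] gives p, q, s, the
    polynomial part of [D0] gives u and d, and its two polar parts are the two
    conditions on the parameters of the system ([second_component_Heun_iff]).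

    The local solution is a power series in t = z - z0.  The coefficients of
    the system are combinations of 1/z, 1/(z-1) and 1/(z-1)^2, and dividing a
    power series by c + t is a one-step recursion on its coefficients.
    Carrying along the coefficients of Y1/z, Y1/(z-1), Y1/(z-1)^2, Y2/(z-1) and
    Y2/(z-1)^2 together with those of Y1 and Y2 therefore turns the differential
    system into a one-step linear recursion in dimension seven, with
    uniformly bounded matrices: the coefficients grow at most geometrically,
    without any product of power series. *)

(** * Complex differentiation *)

Local Notation is_Cderive := (is_derive (K := C_AbsRing) (V := C_NormedModule)).

Lemma Cminus_eq_0 (x y : C) : x - y = 0 -> x = y.
Proof.
  intros e. rewrite <- (Cplus_0_l y), <- e. ring.
Qed.

Lemma C_sub_neq_0 (x y : C) : x <> y -> x - y <> 0.
Proof.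
  intros h e. exact (h (Cminus_eq_0 x y e)).
Qed.

(** A remainder bounded by a multiple of the square of the increment is what
    both the inverse function and power series provide directly. *)
Lemma is_Cderive_quadratic (f : C -> C) (x l : C) (r M : R) :
  (0 < r)%R ->
  (forall y, (Cmod (y - x) < r)%R ->
     (Cmod (f y - f x - (y - x) * l) <= M * (Cmod (y - x) * Cmod (y - x)))%R) ->
  is_Cderive f x l.
Proof.
  intros hr H. split.
  - apply is_linear_scal_l.
  - intros x' hx'.
    apply @is_filter_lim_locally_unique in hx'. rewrite <- hx'. clear x' hx'.
    intros eps.
    set (d := Rmin r (eps / (Rabs M + 1))).
    assert (hM : (0 < Rabs M + 1)%R) by (pose proof (Rabs_pos M); lra).
    assert (hd : (0 < d)%R).
    { apply Rmin_glb_lt; [exact hr|]. apply Rdiv_lt_0_compat; [apply cond_pos|exact hM]. }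
    exists (mkposreal d hd). intros y hy.
    change (Cmod (y - x) < d)%R in hy.
    change (Cmod (f y - f x - (y - x) * l) <= eps * Cmod (y - x))%R.
    assert (h1 : (Cmod (y - x) < r)%R) by (eapply Rlt_le_trans; [exact hy|apply Rmin_l]).
    assert (h2 : (Cmod (y - x) < eps / (Rabs M + 1))%R)
      by (eapply Rlt_le_trans; [exact hy|apply Rmin_r]).
    eapply Rle_trans; [apply (H y h1)|].
    rewrite <- Rmult_assoc. apply Rmult_le_compat_r; [apply Cmod_ge_0|].
    apply Rle_trans with ((Rabs M + 1) * Cmod (y - x))%R.
    + apply Rmult_le_compat_r; [apply Cmod_ge_0|]. pose proof (Rle_abs M); lra.
    + apply Rlt_le. apply Rmult_lt_compat_l with (r := (Rabs M + 1)%R) in h2; [|exact hM].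
      replace ((Rabs M + 1) * (eps / (Rabs M + 1)))%R with (pos eps) in h2 by (field; lra).
      exact h2.
Qed.

(** As a normed module over itself, C carries two uniform structures, the
    product one and the one given by the modulus; differentiability only
    refers to the norm, which they share. *)
Lemma is_Cderive_AbsRing (f : C -> C) (x l : C) :
  is_Cderive f x l <->
  is_derive (K := C_AbsRing) (V := AbsRing_NormedModule C_AbsRing) f x l.
Proof.
  split; intros [[h1 h2 h3] h]; split;
    [split; [exact h1|exact h2|exact h3]|exact h|split; [exact h1|exact h2|exact h3]|exact h].
Qed.

Lemma is_Cderive_mult (f g : C -> C) (x l m : C) :
  is_Cderive f x l -> is_Cderive g x m ->
  is_Cderive (fun z => f z * g z) x (l * g x + f x * m).
Proof.
  intros hf hg. apply is_Cderive_AbsRing in hf, hg. apply is_Cderive_AbsRing.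
  exact (is_derive_mult (K := C_AbsRing) f g x l m hf hg Cmult_comm).
Qed.

Lemma is_Cderive_plus (f g : C -> C) (x l m : C) :
  is_Cderive f x l -> is_Cderive g x m ->
  is_Cderive (fun z => f z + g z) x (l + m).
Proof.
  intros hf hg. exact (is_derive_plus (K := C_AbsRing) f g x l m hf hg).
Qed.

Lemma is_Cderive_inv_sub (a x : C) :
  x <> a -> is_Cderive (fun z => / (z - a)) x (- (/ (x - a) * / (x - a))).
Proof.
  intros hx.
  pose proof (C_sub_neq_0 x a hx) as hxa.
  set (r := Cmod (x - a)).
  assert (hr : (0 < r)%R) by (apply Cmod_gt_0; exact hxa).
  apply is_Cderive_quadratic with (r := (r / 2)%R) (M := (2 / (r * r * r))%R); [lra|].
  intros y hy.
  (* within half the distance to the pole, the modulus of [y - a] stays above [r / 2] *)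
  assert (hya : (r / 2 <= Cmod (y - a))%R).
  { assert (h : (r <= Cmod (y - a) + Cmod (y - x))%R).
    { unfold r. replace (x - a) with ((y - a) + - (y - x)) by ring.
      rewrite <- (Cmod_opp (y - x)). apply Cmod_triangle. }
    lra. }
  assert (hya0 : y - a <> 0) by (apply Cmod_gt_0; lra).
  replace (/ (y - a) - / (x - a) - (y - x) * - (/ (x - a) * / (x - a)))
    with ((y - x) * (y - x) * (/ (y - a) * (/ (x - a) * / (x - a)))) by (field; auto).
  rewrite !Cmod_mult, !Cmod_inv by assumption. fold r.
  rewrite Rmult_comm. apply Rmult_le_compat_r;
    [apply Rmult_le_pos; apply Cmod_ge_0|].
  replace (2 / (r * r * r))%R with (/ (r / 2) * (/ r * / r))%R by (field; lra).
  apply Rmult_le_compat_r.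
  - apply Rlt_le, Rmult_lt_0_compat; apply Rinv_0_lt_compat; exact hr.
  - apply Rinv_le_contravar; lra.
Qed.

(** * Complex power series with geometrically growing coefficients *)

Local Notation is_Cseries := (is_series (K := C_AbsRing) (V := C_NormedModule)).

Definition psum (a : nat -> C) (t : C) : C :=
  iota (T := CompleteNormedModule.CompleteSpace C_AbsRing C_CompleteNormedModule)
    (is_series (K := C_AbsRing) (V := C_NormedModule) (fun n => a n * t ^ n)).

Definition geometric_growth (L : R) (a : nat -> C) : Prop :=
  exists K : R, forall n, (Cmod (a n) <= K * L ^ n)%R.

Lemma is_Cseries_unique (a : nat -> C) (l m : C) :
  is_Cseries a l -> is_Cseries a m -> l = m.
Proof.
  intros hl hm.
  exact (filterlim_locally_unique (K := C_AbsRing) (V := C_NormedModule)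
    (F := eventually) (sum_n a) l m hl hm).
Qed.

Lemma psum_unique (a : nat -> C) (t l : C) :
  is_Cseries (fun n => a n * t ^ n) l -> psum a t = l.
Proof.
  intros hl. apply is_Cseries_unique with (2 := hl).
  apply (iota_correct (K := C_AbsRing) (V := C_CompleteNormedModule)
           (is_Cseries (fun n => a n * t ^ n))). exists l. split; [exact hl|].
  intros m hm. exact (is_Cseries_unique _ _ _ hl hm).
Qed.

Lemma is_Cseries_bound (a : nat -> C) (b : nat -> R) (l : C) (m : R) :
  is_Cseries a l -> is_series b m -> (forall n, (Cmod (a n) <= b n)%R) ->
  (Cmod l <= m)%R.
Proof.
  intros ha hb hab.
  assert (h : is_lim_seq (fun n => Cmod (sum_n (G := C_NormedModule) a n)) (Cmod l)).
  { apply (filterlim_comp _ _ _ (sum_n (G := C_NormedModule) a) Cmod eventually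
             (locally (T := C_UniformSpace) l) (Rbar_locally (Cmod l)) ha).
    exact (filterlim_norm (K := C_AbsRing) (V := C_NormedModule) l). }
  assert (h' : is_lim_seq (sum_n b) m) by exact hb.
  refine (is_lim_seq_le _ _ (Cmod l) m _ h h').
  intros n. unfold sum_n.
  eapply Rle_trans; [apply (norm_sum_n_m (K := C_AbsRing) (V := C_NormedModule) a 0 n)|].
  apply sum_n_m_le. exact hab.
Qed.

Lemma is_series_geom_scal (c q : R) :
  (0 <= q < 1)%R -> is_series (fun n => c * q ^ n)%R (c * / (1 - q))%R.
Proof.
  intros hq.
  apply (is_series_scal (K := R_AbsRing) (V := R_NormedModule) c (fun n => q ^ n)%R).
  apply is_series_geom. rewrite Rabs_pos_eq; lra.
Qed.

(** The factor 4 leaves room for termwise differentiation: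
    [Cpow_taylor_bound] costs a factor 3 per degree. *)
Lemma psum_correct (L : R) (a : nat -> C) (t : C) :
  (0 < L)%R -> geometric_growth L a -> (4 * L * Cmod t <= 1)%R ->
  is_Cseries (fun n => a n * t ^ n) (psum a t).
Proof.
  intros hL [K hK] ht.
  destruct (ex_series_le (K := C_AbsRing) (V := C_CompleteNormedModule)
    (fun n => a n * t ^ n) (fun n => K * (/ 4) ^ n)%R) as [l hl].
  - intros n. change (Cmod (a n * t ^ n) <= K * (/ 4) ^ n)%R.
    rewrite Cmod_mult, Cmod_pow.
    apply Rle_trans with (K * L ^ n * Cmod t ^ n)%R.
    + apply Rmult_le_compat_r; [apply pow_le, Cmod_ge_0|apply hK].
    + rewrite Rmult_assoc, <- Rpow_mult_distr.
      apply Rmult_le_compat_l.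
      * specialize (hK 0%nat). pose proof (Cmod_ge_0 (a 0%nat)). simpl in hK. lra.
      * apply pow_incr. pose proof (Cmod_ge_0 t).
        pose proof (Rmult_le_pos L (Cmod t)). lra.
  - exists (K * / (1 - / 4))%R. apply is_series_geom_scal. lra.
  - rewrite (psum_unique a t l); exact hl.
Qed.

Lemma geometric_growth_plus (L : R) (a b : nat -> C) :
  geometric_growth L a -> geometric_growth L b ->
  geometric_growth L (fun n => a n + b n).
Proof.
  intros [K hK] [M hM]. exists (K + M)%R. intros n.
  eapply Rle_trans; [apply Cmod_triangle|]. rewrite Rmult_plus_distr_r.
  apply Rplus_le_compat; auto.
Qed.

Lemma geometric_growth_scal (L : R) (c : C) (a : nat -> C) :
  geometric_growth L a -> geometric_growth L (fun n => c * a n).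
Proof.
  intros [K hK]. exists (Cmod c * K)%R. intros n.
  rewrite Cmod_mult, Rmult_assoc. apply Rmult_le_compat_l; [apply Cmod_ge_0|auto].
Qed.

Lemma geometric_growth_shift (L : R) (a : nat -> C) :
  geometric_growth L a -> geometric_growth L (fun n => a (S n)).
Proof.
  intros [K hK]. exists (K * L)%R. intros n.
  rewrite Rmult_assoc. exact (hK (S n)).
Qed.

Lemma psum_plus (L : R) (a b : nat -> C) (t : C) :
  (0 < L)%R -> geometric_growth L a -> geometric_growth L b ->
  (4 * L * Cmod t <= 1)%R ->
  psum (fun n => a n + b n) t = psum a t + psum b t.
Proof.
  intros hL ha hb ht. apply psum_unique.
  apply is_series_ext with (fun n => plus (a n * t ^ n) (b n * t ^ n)).
  - intros n. change (a n * t ^ n + b n * t ^ n = (a n + b n) * t ^ n). ring.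
  - apply (is_series_plus (K := C_AbsRing) (V := C_NormedModule));
      apply psum_correct with L; assumption.
Qed.

Lemma psum_scal (L : R) (c : C) (a : nat -> C) (t : C) :
  (0 < L)%R -> geometric_growth L a -> (4 * L * Cmod t <= 1)%R ->
  psum (fun n => c * a n) t = c * psum a t.
Proof.
  intros hL ha ht. apply psum_unique.
  apply is_series_ext with (fun n => scal (V := C_NormedModule) c (a n * t ^ n)).
  - intros n. change (c * (a n * t ^ n) = c * a n * t ^ n). ring.
  - apply (is_series_scal (K := C_AbsRing) (V := C_NormedModule)).
    apply psum_correct with L; assumption.
Qed.

Lemma psum_shift (L : R) (a : nat -> C) (t : C) :
  (0 < L)%R -> geometric_growth L a -> (4 * L * Cmod t <= 1)%R ->
  psum a t = a 0%nat + t * psum (fun n => a (S n)) t.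
Proof.
  intros hL ha ht. apply psum_unique.
  apply (is_series_decr_1 (K := C_AbsRing) (V := C_NormedModule)).
  change (is_Cseries (fun k => a (S k) * t ^ (S k))
    (a 0%nat + t * psum (fun n => a (S n)) t + - (a 0%nat * t ^ 0))).
  replace (a 0%nat + t * psum (fun n => a (S n)) t + - (a 0%nat * t ^ 0))
    with (t * psum (fun n => a (S n)) t) by (simpl; ring).
  apply is_series_ext with (fun n => scal (V := C_NormedModule) t (a (S n) * t ^ n)).
  - intros n. change (t * (a (S n) * t ^ n) = a (S n) * (t * t ^ n)). ring.
  - apply (is_series_scal (K := C_AbsRing) (V := C_NormedModule)).
    apply psum_correct with L; [assumption| |assumption].
    apply geometric_growth_shift. assumption.
Qed.

(** The coefficient of index n in the quotient of a power series by c + t, from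
    the coefficient [y] of index n in the dividend and the coefficient [prev]
    of index n-1 in the quotient. *)
Definition quotient_coef (c y prev : C) : C := / c * (y - prev).

(** Multiplying out, c q(n+1) + q(n) = a(n+1): this is the identity
    (c + t) * psum q t = psum a t, degree by degree. *)
Lemma psum_quotient (L : R) (a q : nat -> C) (c t : C) :
  (0 < L)%R -> geometric_growth L a -> geometric_growth L q ->
  (4 * L * Cmod t <= 1)%R -> c <> 0 -> c + t <> 0 ->
  q 0%nat = quotient_coef c (a 0%nat) 0 ->
  (forall n, q (S n) = quotient_coef c (a (S n)) (q n)) ->
  psum q t = / (c + t) * psum a t.
Proof.
  intros hL ha hq ht hc hct h0 hS.
  assert (e : (c + t) * psum q t = psum a t).
  { rewrite (psum_shift L a) by assumption.
    replace (psum (fun n => a (S n)) t)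
      with (psum (fun n => c * q (S n) + q n) t).
    2:{ f_equal. apply functional_extensionality. intros n.
        rewrite hS. unfold quotient_coef. field. exact hc. }
    pose proof (geometric_growth_shift L q hq) as hq'.
    rewrite (psum_plus L) by (try apply geometric_growth_scal; assumption).
    rewrite (psum_scal L c (fun n => q (S n))) by assumption.
    replace (a 0%nat) with (c * q 0%nat)
      by (rewrite h0; unfold quotient_coef; field; exact hc).
    transitivity (c * (q 0%nat + t * psum (fun n => q (S n)) t) + t * psum q t); [|ring].
    rewrite <- (psum_shift L q) by assumption. ring. }
  rewrite <- e. field. exact hct.
Qed.

(** The remainder r(n) of order two satisfies
    r(n+1) = y r(n) + (y - x)^2 n x^(n-1), and n <= 2 * 3^n absorbs the last
    term.  A bound polynomial in n would be sharper, but a geometric one makes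
    the sum over n immediate. *)
Lemma Cpow_taylor_bound (rho : R) (x y : C) (n : nat) :
  (0 < rho)%R -> (Cmod x <= rho)%R -> (Cmod y <= rho)%R ->
  (Cmod (y ^ n - x ^ n - (y - x) * (INR n * x ^ pred n))
   <= (3 * rho) ^ n * (/ (rho * rho) * (Cmod (y - x) * Cmod (y - x))))%R.
Proof.
  intros hr hx hy.
  set (Q := (/ (rho * rho) * (Cmod (y - x) * Cmod (y - x)))%R).
  assert (hQ : (0 <= Q)%R).
  { apply Rmult_le_pos.
    - apply Rlt_le, Rinv_0_lt_compat, Rmult_lt_0_compat; exact hr.
    - apply Rmult_le_pos; apply Cmod_ge_0. }
  assert (hh : (Cmod (y - x) * Cmod (y - x) = rho * rho * Q)%R)
    by (unfold Q; field; lra).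
  induction n as [|n IH].
  - simpl. replace (1 - 1 - (y - x) * (0 * 1)) with (RtoC 0) by ring.
    rewrite Cmod_0. lra.
  - replace (y ^ S n - x ^ S n - (y - x) * (INR (S n) * x ^ pred (S n)))
      with (y * (y ^ n - x ^ n - (y - x) * (INR n * x ^ pred n))
            + (y - x) * (y - x) * (INR n * x ^ pred n)).
    2:{ rewrite S_INR, RtoC_plus. destruct n as [|n]; simpl; ring. }
    eapply Rle_trans; [apply Cmod_triangle|].
    rewrite !Cmod_mult, Cmod_R, Cmod_pow, hh.
    assert (hn : (Rabs (INR n) * (rho * Cmod x ^ pred n) <= 2 * 3 ^ n * rho ^ n)%R).
    { rewrite Rabs_pos_eq by apply pos_INR.
      destruct n as [|n]; [simpl; lra|].
      assert (hp : (INR (S n) <= 2 * 3 ^ S n)%R).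
      { clear. induction n as [|n IH]; [simpl; lra|].
        rewrite S_INR. pose proof (pow_R1_Rle 3 (S n)).
        change (3 ^ S (S n))%R with (3 * 3 ^ S n)%R. lra. }
      apply Rmult_le_compat; [apply pos_INR| |exact hp|].
      - apply Rmult_le_pos; [lra|apply pow_le, Cmod_ge_0].
      - simpl. apply Rmult_le_compat_l; [lra|]. apply pow_incr. split; [apply Cmod_ge_0|exact hx]. }
    apply Rle_trans with (rho * ((3 * rho) ^ n * Q) + rho * Q * (2 * 3 ^ n * rho ^ n))%R.
    + apply Rplus_le_compat.
      * apply Rmult_le_compat; [apply Cmod_ge_0|apply Cmod_ge_0|exact hy|exact IH].
      * replace (rho * rho * Q * (Rabs (INR n) * Cmod x ^ pred n))%R
          with (rho * Q * (Rabs (INR n) * (rho * Cmod x ^ pred n)))%R by ring.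
        apply Rmult_le_compat_l; [|exact hn]. apply Rmult_le_pos; lra.
    + rewrite !Rpow_mult_distr. simpl. apply Req_le. ring.
Qed.

(** The remainder of the sum is the sum of the remainders; on the disc of
    radius rho = 1/(4L) the n-th one is at most a multiple of
    L^n (3 rho)^n |y-x|^2 = (3/4)^n |y-x|^2. *)
Lemma is_Cderive_psum (L : R) (a b : nat -> C) (z0 z : C) :
  (0 < L)%R -> geometric_growth L a -> geometric_growth L b ->
  (forall n, b n = INR (S n) * a (S n)) ->
  (4 * L * Cmod (z - z0) < 1)%R ->
  is_Cderive (fun w => psum a (w - z0)) z (psum b (z - z0)).
Proof.
  intros hL ha hb hab hz.
  set (rho := (/ (4 * L))%R).
  assert (hrho : (0 < rho)%R) by (apply Rinv_0_lt_compat; lra).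
  assert (hrL : (4 * L * rho = 1)%R) by (unfold rho; field; lra).
  set (x := z - z0) in *.
  assert (hx : (Cmod x < rho)%R).
  { apply Rmult_lt_reg_l with (4 * L)%R; lra. }
  destruct ha as [K hK].
  apply is_Cderive_quadratic with (r := (rho - Cmod x)%R) (M := (/ (1 - 3 / 4) * (K / (rho * rho)))%R); [lra|].
  intros w hw. cbv beta.
  fold x. set (y := w - z0).
  assert (e : w - z = y - x) by (unfold x, y; ring).
  rewrite e in hw |- *. clearbody y x. clear e w z z0.
  assert (hy : (Cmod y <= rho)%R).
  { replace y with ((y - x) + x) by ring.
    eapply Rle_trans; [apply Cmod_triangle|]. lra. }
  assert (hy4 : (4 * L * Cmod y <= 1)%R).
  { rewrite <- hrL. apply Rmult_le_compat_l; lra. }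
  assert (ha : geometric_growth L a) by (exists K; exact hK).
  (* the series of the derivative, indexed by the exponent before
     differentiation; its term of index 0 vanishes *)
  assert (hc : is_Cseries (fun n => a n * (INR n * x ^ pred n)) (psum b x)).
  { apply (is_series_decr_1 (K := C_AbsRing) (V := C_NormedModule)).
    change (is_Cseries (fun n => a (S n) * (INR (S n) * x ^ n))
      (psum b x + - (a 0%nat * (INR 0 * x ^ pred 0)))).
    replace (psum b x + - (a 0%nat * (INR 0 * x ^ pred 0))) with (psum b x)
      by (simpl; ring).
    apply is_series_ext with (fun n => b n * x ^ n).
    - intros n. rewrite hab.
      change (INR (S n) * a (S n) * x ^ n = a (S n) * (INR (S n) * x ^ n)). ring.
    - apply psum_correct with L; [assumption|assumption|lra]. }
  assert (hs : is_Cseries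
    (fun n => a n * (y ^ n - x ^ n - (y - x) * (INR n * x ^ pred n)))
    (psum a y - psum a x - (y - x) * psum b x)).
  { apply is_series_ext with
      (fun n => plus (plus (a n * y ^ n) (opp (a n * x ^ n)))
        (opp (scal (V := C_NormedModule) (y - x) (a n * (INR n * x ^ pred n))))).
    - intros n.
      change (a n * y ^ n + - (a n * x ^ n) + - ((y - x) * (a n * (INR n * x ^ pred n)))
        = a n * (y ^ n - x ^ n - (y - x) * (INR n * x ^ pred n))). ring.
    - apply (is_series_minus (K := C_AbsRing) (V := C_NormedModule));
        [apply (is_series_minus (K := C_AbsRing) (V := C_NormedModule))|].
      + apply psum_correct with L; assumption.
      + apply psum_correct with L; [assumption|assumption|lra].
      + apply (is_series_scal (K := C_AbsRing) (V := C_NormedModule)). exact hc. }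
  set (Q := (/ (rho * rho) * (Cmod (y - x) * Cmod (y - x)))%R).
  replace (/ (1 - 3 / 4) * (K / (rho * rho)) * (Cmod (y - x) * Cmod (y - x)))%R
    with (K * Q * / (1 - 3 / 4))%R by (unfold Q; field; lra).
  apply (is_Cseries_bound _ (fun n => K * Q * (3 / 4) ^ n)%R _ _ hs).
  - apply is_series_geom_scal. lra.
  - intros n. rewrite Cmod_mult.
    eapply Rle_trans.
    + apply Rmult_le_compat; [apply Cmod_ge_0|apply Cmod_ge_0|apply hK|].
      apply Cpow_taylor_bound with (rho := rho); lra.
    + fold Q. apply Req_le.
      replace (3 / 4)%R with (L * (3 * rho))%R by lra.
      rewrite (Rpow_mult_distr L). ring.
Qed.

(** * Local solutions of the system *)

(** The coefficients of a given index in the expansions at z0 of Y1, Y2, Y1/z,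
    Y1/w, Y1/w^2, Y2/w and Y2/w^2, where w = z - 1. *)
Record coefs : Type := Coefs {
  cY1 : C; cY2 : C;
  cY1_z : C; cY1_w : C; cY1_w2 : C;
  cY2_w : C; cY2_w2 : C }.

Definition next_coefs (z0 y1 y2 : C) (prev : coefs) : coefs :=
  let w0 := z0 - 1 in
  let h1 := quotient_coef w0 y1 (cY1_w prev) in
  let h2 := quotient_coef w0 y2 (cY2_w prev) in
  Coefs y1 y2
    (quotient_coef z0 y1 (cY1_z prev))
    h1 (quotient_coef w0 h1 (cY1_w2 prev))
    h2 (quotient_coef w0 h2 (cY2_w2 prev)).

Definition row1 (nu a2 b a1 : C) (s : coefs) : C :=
  nu * cY1_z s + (a2 * cY1_w2 s + b * cY2_w2 s) + a1 * cY1_w s.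

Definition row2 (e d c : C) (s : coefs) : C :=
  e * cY1_w2 s + d * cY2_w2 s + c * cY2_w s.

(** In the first step the coefficients of index -1 are zero.  In the
    successor case, the rows give the coefficients of Y1' and Y2' of index n,
    which are n+1 times those of Y1 and Y2 of index n+1. *)
Fixpoint solution_coefs (nu a2 b a1 e d c z0 v1 v2 : C) (n : nat) : coefs :=
  match n with
  | O => next_coefs z0 v1 v2 (Coefs 0 0 0 0 0 0 0)
  | S n =>
      let s := solution_coefs nu a2 b a1 e d c z0 v1 v2 n in
      next_coefs z0 (/ INR (S n) * row1 nu a2 b a1 s)
        (/ INR (S n) * row2 e d c s) s
  end.

Definition coefs_le (T : R) (s : coefs) : Prop :=
  ((Cmod (cY1 s) <= T /\ Cmod (cY2 s) <= T) /\
   (Cmod (cY1_z s) <= T /\ Cmod (cY1_w s) <= T /\ Cmod (cY1_w2 s) <= T) /\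
   (Cmod (cY2_w s) <= T /\ Cmod (cY2_w2 s) <= T))%R.

Lemma quotient_coef_le (c y prev : C) (A X P : R) :
  (Cmod (/ c) <= A)%R -> (Cmod y <= X)%R -> (Cmod prev <= P)%R ->
  (Cmod (quotient_coef c y prev) <= A * (X + P))%R.
Proof.
  intros hA hX hP. unfold quotient_coef. rewrite Cmod_mult.
  apply Rmult_le_compat; [apply Cmod_ge_0|apply Cmod_ge_0|exact hA|].
  eapply Rle_trans; [apply Cmod_triangle|]. rewrite Cmod_opp. lra.
Qed.

Lemma Cmod_mult_le (x y : C) (X Y : R) :
  (Cmod x <= X)%R -> (Cmod y <= Y)%R -> (Cmod (x * y) <= X * Y)%R.
Proof.
  intros hx hy. rewrite Cmod_mult.
  apply Rmult_le_compat; try apply Cmod_ge_0; assumption.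
Qed.

Lemma Cmod_plus_le (x y : C) (X Y : R) :
  (Cmod x <= X)%R -> (Cmod y <= Y)%R -> (Cmod (x + y) <= X + Y)%R.
Proof.
  intros hx hy. eapply Rle_trans; [apply Cmod_triangle|lra].
Qed.

Lemma next_coefs_le (z0 y1 y2 : C) (s : coefs) (A T : R) :
  (1 <= A)%R -> (Cmod (/ z0) <= A)%R -> (Cmod (/ (z0 - 1)) <= A)%R ->
  (Cmod y1 <= T)%R -> (Cmod y2 <= T)%R -> coefs_le T s ->
  coefs_le (3 * (A * A) * T) (next_coefs z0 y1 y2 s).
Proof.
  intros hA hz hw h1 h2 [[_ _] [[s1 [s2 s3]] [s4 s5]]].
  pose proof (Cmod_ge_0 y1) as hT.
  assert (l1 : (T <= A * T)%R) by nra.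
  assert (l2 : (A * T <= A * A * T)%R) by nra.
  assert (q1 : (Cmod (quotient_coef z0 y1 (cY1_z s)) <= A * (T + T))%R)
    by (apply quotient_coef_le; assumption).
  assert (q2 : (Cmod (quotient_coef (z0 - 1) y1 (cY1_w s)) <= A * (T + T))%R)
    by (apply quotient_coef_le; assumption).
  assert (q3 : (Cmod (quotient_coef (z0 - 1) y2 (cY2_w s)) <= A * (T + T))%R)
    by (apply quotient_coef_le; assumption).
  pose proof (quotient_coef_le (z0 - 1) _ _ A _ _ hw q2 s3) as q4.
  pose proof (quotient_coef_le (z0 - 1) _ _ A _ _ hw q3 s5) as q5.
  unfold coefs_le; cbn; repeat split; lra.
Qed.

Lemma inv_INR_mult_le (n : nat) (x : C) (X : R) :
  (Cmod x <= X)%R -> (Cmod (/ INR (S n) * x) <= X)%R.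
Proof.
  intros hx. replace X with (1 * X)%R by ring. apply Cmod_mult_le; [|exact hx].
  rewrite <- RtoC_inv by apply not_0_INR, Nat.neq_succ_0.
  assert (h : (1 <= INR (S n))%R) by (rewrite S_INR; pose proof (pos_INR n); lra).
  rewrite Cmod_R, Rabs_pos_eq.
  - rewrite <- Rinv_1. apply Rinv_le_contravar; lra.
  - apply Rlt_le, Rinv_0_lt_compat. lra.
Qed.

(** Division by n+1 does not increase a modulus, so the recursion is bounded by
    one constant at all steps. *)
Lemma solution_coefs_le (nu a2 b a1 e d c z0 v1 v2 : C) :
  exists K L : R, (0 < L)%R /\
    forall n, coefs_le (K * L ^ n) (solution_coefs nu a2 b a1 e d c z0 v1 v2 n).
Proof.
  set (A := (1 + Cmod (/ z0) + Cmod (/ (z0 - 1)) + Cmod nu + Cmod a2 + Cmod b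
             + Cmod a1 + Cmod e + Cmod d + Cmod c)%R).
  set (T0 := (Cmod v1 + Cmod v2)%R).
  assert (hA : (1 <= A /\ Cmod (/ z0) <= A /\ Cmod (/ (z0 - 1)) <= A /\
    (Cmod nu <= A /\ Cmod a2 <= A /\ Cmod b <= A /\ Cmod a1 <= A) /\
    (Cmod e <= A /\ Cmod d <= A /\ Cmod c <= A))%R).
  { unfold A.
    pose proof (Cmod_ge_0 (/ z0)); pose proof (Cmod_ge_0 (/ (z0 - 1)));
    pose proof (Cmod_ge_0 nu); pose proof (Cmod_ge_0 a2); pose proof (Cmod_ge_0 b);
    pose proof (Cmod_ge_0 a1); pose proof (Cmod_ge_0 e); pose proof (Cmod_ge_0 d);
    pose proof (Cmod_ge_0 c). repeat split; lra. }
  clearbody A. destruct hA as (hA & hz & hw & (r1 & r2 & r3 & r4) & (r5 & r6 & r7)).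
  assert (hT0 : (0 <= T0)%R)
    by (unfold T0; pose proof (Cmod_ge_0 v1); pose proof (Cmod_ge_0 v2); lra).
  (* [row1] has four terms, whence 4 A; the quotients cost 3 A^2 more *)
  exists (3 * (A * A) * T0)%R, (3 * (A * A) * (4 * A))%R.
  split; [nra|].
  induction n as [|n IH].
  - rewrite pow_O, Rmult_1_r. apply next_coefs_le; try assumption.
    + unfold T0. pose proof (Cmod_ge_0 v2); lra.
    + unfold T0. pose proof (Cmod_ge_0 v1); lra.
    + unfold coefs_le; cbn; rewrite Cmod_0; repeat split; exact hT0.
  - cbn [solution_coefs].
    set (s := solution_coefs nu a2 b a1 e d c z0 v1 v2 n) in *. clearbody s.
    set (T := (3 * (A * A) * T0 * (3 * (A * A) * (4 * A)) ^ n)%R) in *.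
    replace (3 * (A * A) * T0 * (3 * (A * A) * (4 * A)) ^ S n)%R
      with (3 * (A * A) * (4 * A * T))%R by (unfold T; simpl; ring).
    assert (hT : (0 <= T)%R).
    { destruct IH as [[h _] _]. pose proof (Cmod_ge_0 (cY1 s)). lra. }
    clearbody T.
    assert (hAT : (0 <= A * T)%R) by (apply Rmult_le_pos; lra).
    assert (hTT : (T <= 4 * A * T)%R) by nra.
    pose proof IH as [[s1 s2] [[s3 [s4 s5]] [s6 s7]]].
    apply next_coefs_le; try assumption.
    + apply inv_INR_mult_le. unfold row1.
      replace (4 * A * T)%R with (A * T + (A * T + A * T) + A * T)%R by ring.
      repeat apply Cmod_plus_le; apply Cmod_mult_le; assumption.
    + apply inv_INR_mult_le. unfold row2.
      apply Rle_trans with (A * T + A * T + A * T)%R; [|lra].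
      repeat apply Cmod_plus_le; apply Cmod_mult_le; assumption.
    + unfold coefs_le in *. repeat split; lra.
Qed.

Lemma open_Cball (z0 : C) (r : R) : open (fun z : C => (Cmod (z - z0) < r)%R).
Proof.
  intros z hz.
  assert (he : (0 < (r - Cmod (z - z0)) / 2)%R) by lra.
  exists (mkposreal _ he). intros y hy.
  pose proof (C_NormedModule_mixin_compat2 z y (mkposreal _ he) hy) as h.
  change (Cmod (y - z) < sqrt 2 * ((r - Cmod (z - z0)) / 2))%R in h.
  pose proof (Rmult_lt_compat_r ((r - Cmod (z - z0)) / 2) (sqrt 2) 2 he) as h2.
  assert (hs : (sqrt 2 < 2)%R).
  { rewrite <- (sqrt_Rsqr 2) at 2 by lra. apply sqrt_lt_1; unfold Rsqr; lra. }
  replace (y - z0) with ((y - z) + (z - z0)) by ring.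
  eapply Rle_lt_trans; [apply Cmod_triangle|]. specialize (h2 hs). lra.
Qed.

(** The radius is chosen so that the series converge and neither singular
    point is in the disc. *)
Lemma system_local_solution (b g : R) (nu a1 a2 z0 v1 v2 : C) :
  z0 <> 0 -> z0 <> 1 ->
  exists (U : C -> Prop) (Y1 Y2 : C -> C),
    regular_domain U /\ U z0 /\ solves_system b g nu a1 a2 U Y1 Y2 /\
    Y1 z0 = v1 /\ Y2 z0 = v2.
Proof.
  intros hz0 hz1.
  pose proof (C_sub_neq_0 _ _ hz1) as hw0.
  set (d := a2 - g). set (c := a1 + nu - Cconj nu).
  set (s := solution_coefs nu a2 b a1 (- b) d c z0 v1 v2).
  destruct (solution_coefs_le nu a2 b a1 (- b) d c z0 v1 v2) as (K & L & hL & hs).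
  fold s in hs.
  assert (gY1 : geometric_growth L (fun n => cY1 (s n))) by (exists K; intros n; apply (hs n)).
  assert (gY2 : geometric_growth L (fun n => cY2 (s n))) by (exists K; intros n; apply (hs n)).
  assert (gG : geometric_growth L (fun n => cY1_z (s n))) by (exists K; intros n; apply (hs n)).
  assert (gH1 : geometric_growth L (fun n => cY1_w (s n))) by (exists K; intros n; apply (hs n)).
  assert (gK1 : geometric_growth L (fun n => cY1_w2 (s n))) by (exists K; intros n; apply (hs n)).
  assert (gH2 : geometric_growth L (fun n => cY2_w (s n))) by (exists K; intros n; apply (hs n)).
  assert (gK2 : geometric_growth L (fun n => cY2_w2 (s n))) by (exists K; intros n; apply (hs n)).
  set (r := Rmin (/ (4 * L)) (Rmin (Cmod z0) (Cmod (z0 - 1)))).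
  exists (fun z => (Cmod (z - z0) < r)%R),
    (fun z => psum (fun n => cY1 (s n)) (z - z0)),
    (fun z => psum (fun n => cY2 (s n)) (z - z0)).
  assert (hr : (0 < r)%R).
  { unfold r. repeat apply Rmin_glb_lt.
    - apply Rinv_0_lt_compat. lra.
    - apply Cmod_gt_0, hz0.
    - apply Cmod_gt_0, hw0. }
  assert (hUL : forall z, (Cmod (z - z0) < r)%R -> (4 * L * Cmod (z - z0) < 1)%R).
  { intros z hz. apply Rmult_lt_reg_l with (/ (4 * L))%R; [apply Rinv_0_lt_compat; lra|].
    rewrite <- Rmult_assoc, Rinv_l, Rmult_1_l, Rmult_1_r by lra.
    eapply Rlt_le_trans; [exact hz|apply Rmin_l]. }
  assert (hU0 : ~ (Cmod (0 - z0) < r)%R).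
  { intros h. apply (Rlt_irrefl (Cmod z0)).
    replace (0 - z0) with (- z0) in h by ring. rewrite Cmod_opp in h.
    eapply Rlt_le_trans; [exact h|]. unfold r.
    eapply Rle_trans; [apply Rmin_r|apply Rmin_l]. }
  assert (hU1 : ~ (Cmod (1 - z0) < r)%R).
  { intros h. apply (Rlt_irrefl (Cmod (z0 - 1))).
    replace (1 - z0) with (- (z0 - 1)) in h by ring. rewrite Cmod_opp in h.
    eapply Rlt_le_trans; [exact h|]. unfold r.
    eapply Rle_trans; [apply Rmin_r|apply Rmin_r]. }
  assert (hval : forall a, geometric_growth L a -> psum a (z0 - z0) = a 0%nat).
  { intros a ha. rewrite (psum_shift L) by
      (try assumption; replace (z0 - z0) with (RtoC 0) by ring; rewrite Cmod_0; lra).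
    ring. }
  split; [split; [apply open_Cball|split; assumption]|].
  split; [replace (z0 - z0) with (RtoC 0) by ring; rewrite Cmod_0; exact hr|].
  split; [|split; [rewrite hval by assumption; reflexivity|rewrite hval by assumption; reflexivity]].
  intros z hz. pose proof (hUL z hz) as ht. pose proof (Rlt_le _ _ ht) as ht'.
  assert (hz' : z <> 0) by (intros ->; exact (hU0 hz)).
  assert (hw' : z - 1 <> 0) by (apply C_sub_neq_0; intros ->; exact (hU1 hz)).
  assert (ez : z0 + (z - z0) = z) by ring.
  assert (ew : z0 - 1 + (z - z0) = z - 1) by ring.
  set (F1 := psum (fun n => cY1 (s n)) (z - z0)).
  set (F2 := psum (fun n => cY2 (s n)) (z - z0)).
  assert (eG : psum (fun n => cY1_z (s n)) (z - z0) = / z * F1).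
  { rewrite <- ez at 2. apply (psum_quotient L); try assumption;
      [rewrite ez; exact hz'|reflexivity|reflexivity]. }
  assert (eH1 : psum (fun n => cY1_w (s n)) (z - z0) = / (z - 1) * F1).
  { rewrite <- ew. apply (psum_quotient L); try assumption;
      [rewrite ew; exact hw'|reflexivity|reflexivity]. }
  assert (eH2 : psum (fun n => cY2_w (s n)) (z - z0) = / (z - 1) * F2).
  { rewrite <- ew. apply (psum_quotient L); try assumption;
      [rewrite ew; exact hw'|reflexivity|reflexivity]. }
  assert (eK1 : psum (fun n => cY1_w2 (s n)) (z - z0) = / (z - 1) * (/ (z - 1) * F1)).
  { rewrite <- eH1, <- ew. apply (psum_quotient L); try assumption;
      [rewrite ew; exact hw'|reflexivity|reflexivity]. }
  assert (eK2 : psum (fun n => cY2_w2 (s n)) (z - z0) = / (z - 1) * (/ (z - 1) * F2)).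
  { rewrite <- eH2, <- ew. apply (psum_quotient L); try assumption;
      [rewrite ew; exact hw'|reflexivity|reflexivity]. }
  assert (hrow : forall n x, x = INR (S n) * (/ INR (S n) * x)).
  { intros n x. field. intros e. apply RtoC_inj in e. exact (not_0_INR _ (Nat.neq_succ_0 n) e). }
  split.
  - replace (1 / z * (nu * F1 + 0 * F2) + 1 / (z - 1) ^ 2 * (a2 * F1 + b * F2)
             + 1 / (z - 1) * (a1 * F1 + 0 * F2))
      with (psum (fun n => row1 nu a2 b a1 (s n)) (z - z0)).
    + apply is_Cderive_psum with L; try assumption.
      * unfold row1. repeat apply geometric_growth_plus;
          apply geometric_growth_scal; assumption.
      * intros n. apply hrow.
    + unfold row1.
      rewrite !(psum_plus L), !(psum_scal L), eG, eH1, eK1, eK2 by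
        (try assumption; repeat apply geometric_growth_plus;
         apply geometric_growth_scal; assumption).
      field. split; assumption.
  - replace (1 / z * (0 * F1 + 0 * F2) + 1 / (z - 1) ^ 2 * (- b * F1 + (a2 - g) * F2)
             + 1 / (z - 1) * (0 * F1 + (a1 + nu - Cconj nu) * F2))
      with (psum (fun n => row2 (- b) d c (s n)) (z - z0)).
    + apply is_Cderive_psum with L; try assumption.
      * unfold row2. repeat apply geometric_growth_plus;
          apply geometric_growth_scal; assumption.
      * intros n. apply hrow.
    + unfold row2.
      rewrite !(psum_plus L), !(psum_scal L), eH2, eK1, eK2 by
        (try assumption; repeat apply geometric_growth_plus;
         apply geometric_growth_scal; assumption).
      unfold d, c. field. split; assumption.
Qed.

(** * The defect of the confluent Heun equation *)

Lemma locally_of_open (U : C -> Prop) (z : C) :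
  open U -> U z -> locally (T := AbsRing_UniformSpace C_AbsRing) z U.
Proof.
  intros hU hz. destruct (hU z hz) as [eps he].
  exists eps. intros y hy. apply he.
  exact (C_NormedModule_mixin_compat1 z y eps hy).
Qed.

(** The coefficient of Y2' in the candidate equation, minus its coefficient in
    the equation with the same leading term that elimination of Y1 gives. *)
Definition defect1 (g : R) (nu a1 a2 p q s z : C) : C :=
  p * (z * (z - 1)) + q * z + s
  + nu * (z - 1) ^ 2 + (2 * a2 - g) * z
  + (2 * a1 + nu - Cconj nu - 2) * (z * (z - 1)).

(** The same difference for the coefficients of Y2, in partial fractions. *)
Definition defect0 (b g : R) (nu a1 a2 u d z : C) : C :=
  u * z + d
  - ((a1 + nu - 1) * (a1 + nu - Cconj nu) * z + nu * (a2 - g - a1 - nu + Cconj nu))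
  - z / (z - 1) ^ 2 * (b ^ 2 - a2 * (g - a2))
  - z / (z - 1) * (a2 * (nu - Cconj nu) + a1 * (2 * a2 - g)).

(** On U, the derivative of Y2 is the second row of the system, an expression
    in Y1 and Y2 that can be differentiated again with the first row. *)
Lemma Heun_defect (b g : R) (nu a1 a2 p q s u d : C)
    (U : C -> Prop) (Y1 Y2 : C -> C) (z : C) :
  regular_domain U -> solves_system b g nu a1 a2 U Y1 Y2 -> U z ->
  ex_derive (K := C_AbsRing) (V := C_NormedModule) Y2 z /\
  ex_derive (K := C_AbsRing) (V := C_NormedModule) (C_derive Y2) z /\
  z * (z - 1) ^ 2 * C_derive (C_derive Y2) z
    + (p * (z * (z - 1)) + q * z + s) * C_derive Y2 z + (u * z + d) * Y2 z
  = defect1 g nu a1 a2 p q s z * C_derive Y2 z + defect0 b g nu a1 a2 u d z * Y2 z.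
Proof.
  intros [hU [hU0 hU1]] hY hz.
  assert (h0 : forall y, U y -> y <> 0) by (intros y hy ->; exact (hU0 hy)).
  assert (h1 : forall y, U y -> y <> 1) by (intros y hy ->; exact (hU1 hy)).
  set (c := a1 + nu - Cconj nu).
  set (V := fun y => - b * (/ (y - 1) * / (y - 1) * Y1 y)
    + ((a2 - g) * (/ (y - 1) * / (y - 1) * Y2 y) + c * (/ (y - 1) * Y2 y))).
  assert (hV : forall y, U y -> is_Cderive Y2 y (V y)).
  { intros y hy. destruct (hY y hy) as [_ h].
    replace (V y) with
      (1 / y * (0 * Y1 y + 0 * Y2 y)
       + 1 / (y - 1) ^ 2 * (- b * Y1 y + (a2 - g) * Y2 y)
       + 1 / (y - 1) * (0 * Y1 y + (a1 + nu - Cconj nu) * Y2 y)); [exact h|].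
    unfold V, c. field. split; [apply C_sub_neq_0, h1, hy|apply h0, hy]. }
  pose proof (h0 z hz) as hz0. pose proof (C_sub_neq_0 _ _ (h1 z hz)) as hz1.
  pose proof (is_Cderive_inv_sub 1 z (h1 z hz)) as di.
  pose proof (is_Cderive_mult _ _ z _ _ di di) as dii.
  destruct (hY z hz) as [d1 _]. pose proof (hV z hz) as d2.
  pose proof (is_Cderive_plus _ _ z _ _
    (is_Cderive_mult (fun _ => - b) _ z 0 _
       (is_derive_const (K := C_AbsRing) (V := C_NormedModule) (- b) z)
       (is_Cderive_mult _ _ z _ _ dii d1))
    (is_Cderive_plus _ _ z _ _
       (is_Cderive_mult (fun _ => a2 - g) _ z 0 _
          (is_derive_const (K := C_AbsRing) (V := C_NormedModule) (a2 - g) z)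
          (is_Cderive_mult _ _ z _ _ dii d2))
       (is_Cderive_mult (fun _ => c) _ z 0 _
          (is_derive_const (K := C_AbsRing) (V := C_NormedModule) c z)
          (is_Cderive_mult _ _ z _ _ di d2)))) as dV.
  cbv beta in dV.
  match type of dV with is_derive _ _ ?x => set (V' := x) in dV end.
  assert (dd : is_Cderive (C_derive Y2) z V').
  { apply (is_derive_ext_loc (K := C_AbsRing) (V := C_NormedModule)) with (2 := dV).
    apply (filter_imp U); [|apply locally_of_open; assumption].
    intros y hy. symmetry. apply is_C_derive_unique. exact (hV y hy). }
  split; [exists (V z); exact d2|]. split; [exists V'; exact dd|].
  rewrite (is_C_derive_unique _ _ _ dd), (is_C_derive_unique _ _ _ d2).
  unfold V', V, defect1, defect0, c. field. split; assumption.
Qed.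

Lemma Heun_iff_defects_vanish (b g : R) (nu a1 a2 p q s u d : C) (hb : b <> 0%R) :
  second_component_satisfies_Heun b g nu a1 a2 p q s u d <->
  (forall z : C, z <> 0 -> z <> 1 ->
     defect1 g nu a1 a2 p q s z = 0 /\ defect0 b g nu a1 a2 u d z = 0).
Proof.
  split.
  - intros H z hz0 hz1.
    pose proof (C_sub_neq_0 _ _ hz1) as hw.
    assert (hbC : RtoC b <> 0) by (intros e; apply RtoC_inj in e; exact (hb e)).
    assert (key : forall v1 v2 : C,
      defect1 g nu a1 a2 p q s z *
        (1 / z * (0 * v1 + 0 * v2) + 1 / (z - 1) ^ 2 * (- b * v1 + (a2 - g) * v2)
         + 1 / (z - 1) * (0 * v1 + (a1 + nu - Cconj nu) * v2))
      + defect0 b g nu a1 a2 u d z * v2 = 0).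
    { intros v1 v2.
      destruct (system_local_solution b g nu a1 a2 z v1 v2 hz0 hz1)
        as (U & Y1 & Y2 & hU & hUz & hY & <- & <-).
      destruct (Heun_defect b g nu a1 a2 p q s u d U Y1 Y2 z hU hY hUz) as [_ [_ e]].
      destruct (H U Y1 Y2 hU hY z hUz) as [_ [_ e']]. rewrite e' in e.
      destruct (hY z hUz) as [_ h]. rewrite (is_C_derive_unique _ _ _ h) in e.
      symmetry. exact e. }
    (* the solution with Y2 = 0 and Y2' = 1 at z *)
    assert (e1 : defect1 g nu a1 a2 p q s z = 0).
    { pose proof (key (- (z - 1) ^ 2 / b) 0) as e.
      rewrite <- e. field. repeat split; assumption. }
    split; [exact e1|].
    pose proof (key 0 1) as e. rewrite e1 in e. rewrite <- e. ring.
  - intros H U Y1 Y2 hU hY z hz.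
    destruct (Heun_defect b g nu a1 a2 p q s u d U Y1 Y2 z hU hY hz) as [h1 [h2 e]].
    split; [exact h1|]. split; [exact h2|]. rewrite e.
    destruct (H z) as [-> ->].
    + intros ->. exact (proj1 (proj2 hU) hz).
    + intros ->. exact (proj2 (proj2 hU) hz).
    + ring.
Qed.

(** * Comparison of coefficients *)

Lemma RtoC_neq (x y : R) : x <> y -> RtoC x <> RtoC y.
Proof. intros h e. apply h, RtoC_inj, e. Qed.

Lemma quadratic_vanish (k0 k1 k2 : C) :
  (forall z : C, z <> 0 -> z <> 1 -> k2 * (z * (z - 1)) + k1 * z + k0 = 0) ->
  k2 = 0 /\ k1 = 0 /\ k0 = 0.
Proof.
  set (f := fun z : C => k2 * (z * (z - 1)) + k1 * z + k0). intros H.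
  assert (e2 : f 2 = 0) by (apply H; apply RtoC_neq; lra).
  assert (e3 : f 3 = 0) by (apply H; apply RtoC_neq; lra).
  assert (em : f (RtoC (-1)) = 0) by (apply H; apply RtoC_neq; lra).
  repeat split.
  - transitivity ((3 * f 3 - 4 * f 2 + f (RtoC (-1))) / 12);
      [unfold f; field|rewrite e2, e3, em; field].
  - transitivity ((f 2 - f (RtoC (-1))) / 3);
      [unfold f; field|rewrite e2, em; field].
  - transitivity (f 2 + (f (RtoC (-1)) - f 3) / 2);
      [unfold f; field|rewrite e2, e3, em; field].
Qed.

Lemma partial_fractions_vanish (k1 k0 m2 m1 : C) :
  (forall z : C, z <> 0 -> z <> 1 ->
     k1 * z + k0 - z / (z - 1) ^ 2 * m2 - z / (z - 1) * m1 = 0) ->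
  k1 = 0 /\ k0 = 0 /\ m2 = 0 /\ m1 = 0.
Proof.
  set (f := fun z : C => k1 * z + k0 - z / (z - 1) ^ 2 * m2 - z / (z - 1) * m1).
  intros H.
  assert (e2 : f 2 = 0) by (apply H; apply RtoC_neq; lra).
  assert (e3 : f 3 = 0) by (apply H; apply RtoC_neq; lra).
  assert (em : f (RtoC (-1)) = 0) by (apply H; apply RtoC_neq; lra).
  assert (en : f (RtoC (-2)) = 0) by (apply H; apply RtoC_neq; lra).
  (* the weights used below are 60 times the rows of the inverse of the 4 x 4
     matrix of values of the four functions at 2, 3, -1, -2 *)
  assert (comb : forall x2 x3 xm xn : R,
    (x2 * f 2 + x3 * f 3 + xm * f (RtoC (-1)) + xn * f (RtoC (-2))) / 60 = 0).
  { intros x2 x3 xm xn. rewrite e2, e3, em, en. field. }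
  repeat split.
  - rewrite <- (comb (-5) 12 20 (-27))%R. unfold f. field.
  - rewrite <- (comb 30 (-48) 240 (-162))%R. unfold f. field.
  - rewrite <- (comb (-60) 72 (-120) 108)%R. unfold f. field.
  - rewrite <- (comb 40 (-84) 260 (-216))%R. unfold f. field.
Qed.

(** The functions z (z-1), z and 1 are linearly independent, and so are z, 1,
    z/(z-1)^2 and z/(z-1): each coefficient of a vanishing defect vanishes. *)
Lemma second_component_Heun_iff (b g : R) (nu a1 a2 p q s u d : C) (hb : b <> 0%R) :
  second_component_satisfies_Heun b g nu a1 a2 p q s u d <->
  (RtoC b ^ 2 = a2 * (g - a2) /\
   a2 * (nu - Cconj nu) + a1 * (2 * a2 - g) = 0) /\
  (p = Cconj nu + 2 - 2 * nu - 2 * a1 /\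
   q = nu + g - 2 * a2 /\
   s = - nu /\
   u = (a1 + nu - 1) * (a1 + nu - Cconj nu) /\
   d = nu * (a2 - g - a1 - nu + Cconj nu)).
Proof.
  rewrite (Heun_iff_defects_vanish b g nu a1 a2 p q s u d hb). split.
  - intros H.
    destruct (quadratic_vanish (s - - nu) (q - (nu + g - 2 * a2))
      (p - (Cconj nu + 2 - 2 * nu - 2 * a1))) as (hp & hq & hs).
    { intros z h0 h1. rewrite <- (proj1 (H z h0 h1)). unfold defect1. ring. }
    destruct (partial_fractions_vanish
      (u - (a1 + nu - 1) * (a1 + nu - Cconj nu))
      (d - nu * (a2 - g - a1 - nu + Cconj nu))
      (RtoC b ^ 2 - a2 * (g - a2))
      (a2 * (nu - Cconj nu) + a1 * (2 * a2 - g))) as (hu & hd & h2 & h1).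
    { intros z h0 h1. rewrite <- (proj2 (H z h0 h1)). unfold defect0. ring. }
    repeat split; try exact h1; apply Cminus_eq_0; assumption.
  - intros [[h2 h1] (-> & -> & -> & -> & ->)] z _ _.
    split; [unfold defect1; ring|]. unfold defect0. rewrite h2, h1. ring.
Qed.

Theorem theorem20 (b g : R) (nu a1 a2 : C) (hb : b <> 0%R) :
  ((exists p q s u d : C,
      second_component_satisfies_Heun b g nu a1 a2 p q s u d)
   <->
   (RtoC b ^ 2 = a2 * (g - a2) /\
    a2 * (nu - Cconj nu) + a1 * (2 * a2 - g) = 0))
  /\
  (RtoC b ^ 2 = a2 * (g - a2) /\
   a2 * (nu - Cconj nu) + a1 * (2 * a2 - g) = 0 ->
   forall p q s u d : C,
     second_component_satisfies_Heun b g nu a1 a2 p q s u d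
     <->
     (p = Cconj nu + 2 - 2 * nu - 2 * a1 /\
      q = nu + g - 2 * a2 /\
      s = - nu /\
      u = (a1 + nu - 1) * (a1 + nu - Cconj nu) /\
      d = nu * (a2 - g - a1 - nu + Cconj nu))).
Proof.
  split.
  - split.
    + intros (p & q & s & u & d & H).
      apply (second_component_Heun_iff b g nu a1 a2 p q s u d hb) in H. tauto.
    + intros H. do 5 eexists.
      apply (second_component_Heun_iff b g nu a1 a2 _ _ _ _ _ hb).
      split; [exact H|repeat split; reflexivity].
  - intros H p q s u d.
    rewrite (second_component_Heun_iff b g nu a1 a2 p q s u d hb). tauto.
Qed.
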